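(* Let $l>k-m\ge m$. Then $$\bar F_{[k,m],[l]}(x)=R_k(x)-\bigl(x\,R_{k-m}(x)\,R_m(x)\bigr)^{l+m-k}\bigl(R_k(x)-R_{k-m}(x)\bigr).$$
   Context: $\mathfrak{S}_n$ is the set of permutations of $\{1,\dots,n\}$ in one-line notation. A permutation $\pi\in\mathfrak{S}_n$ avoids a pattern $\tau\in\mathfrak{S}_k$ if no subsequence $(\pi_{i_1},\dots,\pi_{i_k})$ with $i_1<\dots<i_k$ is order-isomorphic to $\tau$. $\mathfrak{S}_n(132,\tau_1,\tau_2)$ is the set of permutations in $\mathfrak{S}_n$ avoiding all of $132,\tau_1,\tau_2$, and $\bar F_{\tau_1,\tau_2}(x)=\sum_{n\ge 0}|\mathfrak{S}_n(132,\tau_1,\tau_2)|\,x^n$. $[l]$ denotes the identity pattern $(1,2,\dots,l)\in\mathfrak{S}_l$. For integers $k,m$ with $1\le m\le k-1$, $[k,m]$ denotes the pattern $(m+1,m+2,\dots,k,1,2,\dots,m)\in\mathfrak{S}_k$. $U_r$ is the Chebyshev polynomial of the second kind, $U_r(\cos\theta)=\frac{\sin (r+1)\theta}{\sin\theta}$, equivalently $U_0(y)=1$, $U_1(y)=2y$, $U_r(y)=2yU_{r-1}(y)-U_{r-2}(y)$. For $k\ge 1$, $R_k(x)=\frac{2tU_{k-1}(t)}{U_k(t)}$ with $t=\frac{1}{2\sqrt x}$; this is a rational function of $x$ (e.g. $R_1(x)=1$, $R_2(x)=\frac{1}{1-x}$, $R_3(x)=\frac{1-x}{1-2x}$). The identity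 is an identity of formal power series in $x$. *)

(* Defs.v *)
From mathcomp Require Import all_boot all_order all_fingroup all_algebra.

Set Implicit Arguments.
Unset Strict Implicit.
Unset Printing Implicit Defensive.

Import GRing.Theory.

(* A permutation in 'S_n acts on {0, ..., n-1}: both positions and values are
   shifted down by one with respect to the usual one-line notation. *)
Definition one_line n (s : 'S_n) : seq nat := [seq (s i).+1 | i <- enum 'I_n].

(* [f] lists the positions of a subsequence of [s] order-isomorphic to [tau]. *)
Definition contains k n (tau : 'S_k) (s : 'S_n) : bool :=
  [exists f : {ffun 'I_k -> 'I_n},
     [forall i : 'I_k, forall j : 'I_k, (i < j) ==> (f i < f j)] &&
     [forall i : 'I_k, forall j : 'I_k, (s (f i) < s (f j)) == (tau i < tau j)]].

Definition avoids k n (tau : 'S_k) (s : 'S_n) : bool := ~~ contains tau s.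

Definition pat132 : 'S_3 := tperm (inord 1) (inord 2).

Definition pat_id (l : nat) : 'S_l := 1%g.

(* The pattern m+1, ..., k, 1, ..., m: [ordS] is i |-> i + 1 modulo k, and
   this is its m-fold iterate; see [one_line_pat_rot]. *)
Definition pat_rot (k m : nat) : 'S_k := (perm (@ordS_inj k) ^+ m)%g.

Lemma pat_rotE k m (i : 'I_k) : pat_rot k m i = (i + m) %% k :> nat.
Proof.
rewrite /pat_rot permX; elim: m => [|m IHm] /=.
  by rewrite addn0 modn_small.
by rewrite permE /= IHm -addn1 modnDml addn1 addnS.
Qed.

Lemma one_line_pat_rot k m : m <= k ->
  one_line (pat_rot k m) = iota m.+1 (k - m) ++ iota 1 m.
Proof.
move=> le_mk.
have -> : one_line (pat_rot k m) = [seq ((i + m) %% k).+1 | i <- iota 0 k].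
  rewrite -val_enum_ord -map_comp; apply: eq_map => i /=.
  by rewrite pat_rotE.
rewrite -{2}(subnK le_mk) iotaD map_cat add0n; congr (_ ++ _).
  rewrite -[in RHS](addn0 m.+1) iotaDl; apply/eq_in_map => i.
  by rewrite mem_iota add0n => /andP[_ ltik]; rewrite modn_small addnC // -ltn_subRL.
rewrite -[in LHS](addn0 (k - m)) iotaDl -map_comp -[in RHS](addn0 1) iotaDl.
apply/eq_in_map => i; rewrite mem_iota add0n => /andP[_ ltim] /=.
rewrite add1n addnAC subnK // modnDl modn_small //.
exact: leq_trans ltim le_mk.
Qed.

Lemma one_line_pat_id l : one_line (pat_id l) = iota 1 l.
Proof.
rewrite /one_line -[in RHS](addn0 1) iotaDl -val_enum_ord -map_comp.
by apply: eq_map => i /=; rewrite perm1.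
Qed.

Lemma one_line_pat132 : one_line pat132 = [:: 1; 3; 2].
Proof.
by rewrite /one_line !enum_ordSl enum_ord0 /= !permE /= -!val_eqE /= !inordK.
Qed.

Definition avoiders132 k1 k2 (tau1 : 'S_k1) (tau2 : 'S_k2) (n : nat) : {set 'S_n} :=
  [set s : 'S_n | [&& avoids pat132 s, avoids tau1 s & avoids tau2 s]].

Local Open Scope ring_scope.

(* Coefficients of the generating function of 132-, tau1-, tau2-avoiders. *)
Definition Fbar k1 k2 (tau1 : 'S_k1) (tau2 : 'S_k2) : nat -> rat :=
  fun n => #|avoiders132 tau1 tau2 n|%:R.

(* The Chebyshev polynomials of the second kind. *)
Fixpoint chebU (r : nat) : {poly rat} :=
  match r with
  | 0 => 1
  | 1 => 2 *: 'X
  | (r2.+1 as r1).+1 => 2 *: 'X * chebU r1 - chebU r2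
  end.

(* The field Q(sqrt x) of rational functions in the indeterminate sqrt x. *)
Notation Qsqrtx := {fraction {poly rat}}.

Definition sqrtx : Qsqrtx := tofrac 'X.

Definition varx : Qsqrtx := sqrtx ^+ 2.

Definition polyQ (p : {poly rat}) (y : Qsqrtx) : Qsqrtx :=
  (map_poly (fun c : rat => tofrac c%:P : Qsqrtx) p).[y].

Definition vart : Qsqrtx := (2 * sqrtx)^-1.

(* Only meaningful for k >= 1. *)
Definition R_ (k : nat) : Qsqrtx := 2 * vart * polyQ (chebU k.-1) vart / polyQ (chebU k) vart.

(* [r] is a rational function p(x) / q(x) of x, regular at x = 0, and
   \sum_n a_n x^n is its expansion: q(x) * \sum_n a_n x^n = p(x). *)
Definition has_expansion (a : nat -> rat) (r : Qsqrtx) : Prop :=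
  exists p q : {poly rat},
    [/\ q.[0] != 0, r = polyQ p varx / polyQ q varx &
        forall n, \sum_(i < n.+1) q`_i * a (n - i)%N = p`_n].

Lemma polyQxE p : polyQ p varx = tofrac (p \Po 'X^2).
Proof.
rewrite /polyQ /varx /sqrtx comp_polyE horner_coef.
have inj : injective (fun c : rat => tofrac c%:P : Qsqrtx).
  by move=> c d /eqP; rewrite tofrac_eq => /eqP /polyC_inj.
rewrite size_map_inj_poly ?tofrac0 // rmorph_sum /=.
apply: eq_bigr => i _; rewrite coef_map_id0 ?tofrac0 //.
by rewrite -mul_polyC tofracM -2!tofracXn.
Qed.

Lemma has_expansion_uniq a b r :
  has_expansion a r -> has_expansion b r -> a =1 b.
Proof.
move=> [p [q [q0 rE qa]]] [p' [q' [q'0 rE' qb]]].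
have compN0 (u : {poly rat}) : u.[0] != 0 -> tofrac (u \Po 'X^2) != 0 :> Qsqrtx.
  move=> u0; rewrite tofrac_eq0; apply: contra_neq u0 => u0.
  have := congr1 (fun w : {poly rat} => w.[0]) u0.
  by rewrite horner_comp hornerXn expr0n horner0.
have Epq : p * q' = p' * q.
  move: rE'; rewrite {}rE !polyQxE => /eqP.
  rewrite eqr_div ?compN0 // -!tofracM tofrac_eq -!comp_polyM => /eqP.
  move/eqP; rewrite -subr_eq0 -comp_polyB comp_poly_eq0 ?size_polyXn //.
  by rewrite subr_eq0 => /eqP.
have Q0 : (q * q').[0] != 0 by rewrite hornerM mulf_neq0.
(* truncations of the two series have the same product with q * q' *)
have trunc (u v : {poly rat}) (c : nat -> rat) N :
    (forall n, \sum_(i < n.+1) u`_i * c (n - i)%N = v`_n) ->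
  forall n, (n <= N)%N -> (u * \poly_(i < N.+1) c i)`_n = v`_n.
  move=> uc n lenN; rewrite coefM -uc; apply: eq_bigr => i _.
  by rewrite coef_poly ltnS (leq_trans (leq_subr _ _) lenN).
elim/ltn_ind => N IH.
pose A := \poly_(i < N.+1) a i; pose B := \poly_(i < N.+1) b i.
have E : (q * q' * A)`_N = (q * q' * B)`_N.
  transitivity ((p * q')`_N).
    rewrite mulrAC !coefM; apply: eq_bigr => i _.
    by rewrite (trunc _ _ _ _ qa) // -ltnS.
  rewrite Epq -mulrA [p' * q]mulrC !coefM; apply: eq_bigr => i _.
  by rewrite (trunc _ _ _ _ qb) // leq_subr.
move: E; rewrite !coefM !big_ord_recl /= !subn0 !coef_poly ltnSn -horner_coef0.
have -> : \sum_(i < N) (q * q')`_(bump 0 i) * A`_(N - bump 0 i) =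
          \sum_(i < N) (q * q')`_(bump 0 i) * B`_(N - bump 0 i).
  apply: eq_bigr => i _; rewrite /A /B !coef_poly !ltnS leq_subr IH //.
  by rewrite /bump add1n ltn_subrL (leq_ltn_trans _ (ltn_ord i)).
by move/addIr/(mulfI Q0).
Qed.

(* Main.v *)
Require Import Defs.
From mathcomp Require Import all_boot all_order all_fingroup all_algebra.
From mathcomp Require Import ring zify.

(* A 132-avoiding permutation is u n v with n its maximum, u and v avoiding 132
   and every letter of u larger than every letter of v.  Let a = k - m, let W_j
   count the 132-avoiders without an increasing subsequence of length j, and let
   G_l count those avoiding also [k,m] and [l].  An increasing subsequence cannot
   use letters on both sides of the cut between u n and v, and an occurrence of
   [k,m] that does must split exactly between its two blocks.  Hence
     W_{j+1} = 1 + x W_j W_{j+1},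
     G_l = 1 + x (W_{a-1} G_l + (G_{l-1} - W_{a-1}) W_m)   for l > a,
   with G_a = W_a.  The first equation gives W_j = R_j; since 1 - x R_{a-1} = 1 / R_a,
   the second is an affine recursion in l of ratio x R_a R_m, whose fixed point
   is R_k by the addition formula for Chebyshev polynomials. *)

Set Implicit Arguments.
Unset Strict Implicit.
Unset Printing Implicit Defensive.

Import Order.TTheory GRing.Theory Num.Theory.

(** * Patterns in words *)

(** Subsequences are enumerated by boolean masks, a finite type, so that the existential is itself a
    boolean. *)
Definition occurs (P : pred (seq nat)) (w : seq nat) : bool :=
  [exists b : (size w).-tuple bool, P (mask b w)].

Lemma occursP (P : pred (seq nat)) w :
  reflect (exists2 t, subseq t w & P t) (occurs P w).
Proof.
apply: (iffP existsP) => [[b Pb]|[t /subseqP[b sz_b ->] Pt]].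
  by exists (mask b w); first exact: mask_subseq.
by move/eqP: sz_b => sz_b; exists (Tuple sz_b).
Qed.

Lemma occurs_subseq P w w' : subseq w w' -> occurs P w -> occurs P w'.
Proof.
move=> sww' /occursP[t stw Pt]; apply/occursP; exists t => //.
exact: subseq_trans stw sww'.
Qed.

Lemma eq_occurs P Q w : P =1 Q -> occurs P w = occurs Q w.
Proof. by move=> PQ; apply: eq_existsb => b; rewrite PQ. Qed.

Lemma occurs_nil P : occurs P [::] = P [::].
Proof.
apply/occursP/idP => [[t]|P0]; first by rewrite subseq0 => /eqP->.
by exists [::].
Qed.

Lemma occurs_map P f w : (forall t, P (map f t) = P t) ->
  occurs P (map f w) = occurs P w.
Proof.
move=> Pf; apply/occursP/occursP => -[t].
  by case/subseqP=> b _ -> ; rewrite -map_mask Pf; exists (mask b w) => //; apply: mask_subseq.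
by move=> stw Pt; exists (map f t); rewrite ?map_subseq ?Pf.
Qed.

Lemma subseq_cat_split (T : eqType) (t u v : seq T) : subseq t (u ++ v) ->
  exists t1 t2, [/\ t = t1 ++ t2, subseq t1 u & subseq t2 v].
Proof.
case/subseqP=> b sz_b ->.
exists (mask (take (size u) b) u), (mask (drop (size u) b) v).
rewrite !mask_subseq -mask_cat ?cat_take_drop // size_take sz_b size_cat.
by case: ltnP => // ?; lia.
Qed.

Definition incr (l : nat) : pred (seq nat) :=
  fun t => (size t == l) && sorted ltn t.

(** These are exactly the words order-isomorphic to $[a+m,m]$. *)
Definition rotinc (a m : nat) : pred (seq nat) := fun t =>
  [&& size t == a + m, sorted ltn (take a t), sorted ltn (drop a t) &
      allrel (fun x y => y < x) (take a t) (drop a t)].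

Definition word132 : pred (seq nat) :=
  fun t => if t is [:: x; y; z] then x < z < y else false.

(** One implication is enough: [tau] is injective, so its values at distinct positions are always
    comparable and the converse follows. *)
Definition ordiso k (tau : 'S_k) : pred (seq nat) := fun t =>
  (size t == k) &&
  [forall i : 'I_k, forall j : 'I_k, (tau i < tau j) ==> (nth 0 t i < nth 0 t j)].

Lemma ordisoP k (tau : 'S_k) t :
  reflect (size t = k /\ forall i j : 'I_k, tau i < tau j -> nth 0 t i < nth 0 t j)
          (ordiso tau t).
Proof.
apply: (iffP andP) => -[]; first move/eqP=> sz /forallP H.
  by split=> // i j; have /forallP/(_ j)/implyP := H i.
by move=> /eqP sz H; split=> //; apply/forallP=> i; apply/forallP=> j; apply/implyP/H.
Qed.

Lemma nth_ltn_sorted t i j : sorted ltn t -> i < j < size t -> nth 0 t i < nth 0 t j.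
Proof.
move=> st /andP[ij jt]; apply: (sorted_ltn_nth ltn_trans) => //.
exact: ltn_trans jt.
Qed.

Lemma sorted_ltnP t :
  (forall i j, i < j < size t -> nth 0 t i < nth 0 t j) -> sorted ltn t.
Proof.
move=> H; rewrite (sorted_pairwise ltn_trans); apply/(pairwiseP 0) => i j _ jt ij.
by apply: H; rewrite ij.
Qed.

Lemma ordiso_id l : ordiso (pat_id l) =1 incr l.
Proof.
move=> t; apply/ordisoP/andP => [[sz H]|[/eqP sz st]].
  rewrite sz; split=> //; apply: sorted_ltnP => i j /andP[ij]; rewrite sz => jl.
  have := H (Ordinal (ltn_trans ij jl)) (Ordinal jl).
  by rewrite !perm1; apply.
split=> // i j; rewrite !perm1 => ij.
by apply: nth_ltn_sorted => //; rewrite ij sz ltn_ord.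
Qed.

Lemma ordiso_rot k m : m <= k -> ordiso (pat_rot k m) =1 rotinc (k - m) m.
Proof.
move=> le_mk; have rE (i : 'I_k) :
    pat_rot k m i = (if i < k - m then i + m else i - (k - m)) :> nat.
  rewrite pat_rotE; have := ltn_ord i; case: (ltnP i (k - m)) => ? ?.
    by rewrite modn_small //; lia.
  by rewrite (_ : i + m = (i - (k - m)) + k) ?modnDr ?modn_small; lia.
move=> t; apply/ordisoP/and4P; rewrite subnK //.
- case=> sz H.
  (* The three alternatives list the pairs with [tau i < tau j]: both positions in the first block,
     both in the second, or [j] in the lower second block and [i] in the upper first one. *)
  have {}H i j : i < k -> j < k ->
      [|| i < j < k - m, k - m <= i < j | j < k - m <= i] ->
      nth 0 t i < nth 0 t j.
    move=> ik jk ij; have := H (Ordinal ik) (Ordinal jk); rewrite !rE /=; apply.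
    by case: (ltnP i (k - m)) ij => ?; case: (ltnP j (k - m)) => ?; lia.
  have szt : size (take (k - m) t) = k - m by rewrite size_takel // sz leq_subr.
  rewrite sz eqxx; split=> //.
  + apply: sorted_ltnP => i j; rewrite szt => /andP[ij jk].
    by rewrite !nth_take ?(ltn_trans ij) //; apply: H; lia.
  + apply: sorted_ltnP => i j; rewrite size_drop sz => /andP[ij jk].
    by rewrite !nth_drop; apply: H; lia.
  + apply/allrelP => x y /(nthP 0)[i]; rewrite szt => ik <-.
    case/(nthP 0)=> j; rewrite size_drop sz => jk <-.
    by rewrite nth_take // nth_drop; apply: H; lia.
- case=> /eqP sz st sd /allrelP ar; split=> // i j.
  have ti x : x < k - m -> nth 0 t x = nth 0 (take (k - m) t) x by move=> ?; rewrite nth_take.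
  have di x : k - m <= x -> nth 0 t x = nth 0 (drop (k - m) t) (x - (k - m)).
    by move=> ?; rewrite nth_drop subnKC.
  have szt : size (take (k - m) t) = k - m by rewrite size_takel // sz leq_subr.
  have szd : size (drop (k - m) t) = k - (k - m) by rewrite size_drop sz.
  have ltik := ltn_ord i; have ltjk := ltn_ord j.
  rewrite !rE; case: (ltnP i (k - m)) => ia; case: (ltnP j (k - m)) => ja lt_ij.
  + by rewrite !ti //; apply: nth_ltn_sorted; lia.
  + lia.
  + rewrite (di i) // (ti j) //; apply: ar; apply: mem_nth; rewrite ?szt ?szd; lia.
  + by rewrite !di //; apply: nth_ltn_sorted; lia.
Qed.

Lemma nth_map_ord k (g : 'I_k -> nat) (i : 'I_k) :
  nth 0 [seq g j | j <- enum 'I_k] i = g i.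
Proof. by rewrite (nth_map i) ?size_enum_ord // nth_ord_enum. Qed.

Lemma ordiso_132 : ordiso pat132 =1 word132.
Proof.
have pE (i : 'I_3) : pat132 i = nth 0 [:: 0; 2; 1] i :> nat.
  have := congr1 (fun s => nth 0 s i) one_line_pat132.
  rewrite (nth_map_ord (fun i => (pat132 i).+1)) => /(congr1 predn) /= ->.
  by case: i => [[|[|[|]]]].
move=> t; apply/ordisoP/idP => [[]|].
  case: t => [|x [|y [|z [|]]]] //= _ H.
  have := H (inord 0) (inord 2); have := H (inord 2) (inord 1).
  by rewrite !pE !inordK //= => -> // ->.
case: t => [|x [|y [|z [|]]]] //= /andP[xz zy]; split=> // i j; rewrite !pE.
have xy := ltn_trans xz zy.
by case: i => [[|[|[|]]]] //= _; case: j => [[|[|[|]]]] //= _.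
Qed.

(** * Permutations as words on the letters $0,\dots,n-1$ *)

Definition word n (s : 'S_n) : seq nat := [seq val (s i) | i <- enum 'I_n].

Lemma enum_ord_sorted n : sorted (fun i j : 'I_n => i < j) (enum 'I_n).
Proof.
have : sorted ltn (map val (enum 'I_n)) by rewrite val_enum_ord iota_ltn_sorted.
by rewrite sorted_map.
Qed.

Lemma containsE k n (tau : 'S_k) (s : 'S_n) :
  contains tau s = occurs (ordiso tau) (word s).
Proof.
have tr : transitive (fun i j : 'I_n => i < j) by move=> j i h; apply: ltn_trans.
apply/existsP/occursP => [[f /andP[/forallP fm /forallP fs]]|[t]].
  exists [seq val (s (f i)) | i <- enum 'I_k].
    rewrite map_comp [word s](_ : _ = map (val \o s) (enum 'I_n)) //.
    rewrite (map_comp s f) -map_comp; apply: map_subseq.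
    (* The image of an increasing [f], listed in order, is what remains of the list of all positions
       after filtering. *)
    suff -> : map f (enum 'I_k) = filter [in map f (enum 'I_k)] (enum 'I_n).
      exact: filter_subseq.
    apply: (irr_sorted_eq tr) => [i||| i]; first exact: ltnn.
    - rewrite sorted_map; apply: sub_sorted (enum_ord_sorted k) => i j ij.
      by have /forallP/(_ j)/implyP/(_ ij) := fm i.
    - exact: sorted_filter (enum_ord_sorted n).
    - by rewrite mem_filter mem_enum andbT.
  apply/ordisoP; rewrite size_map size_enum_ord; split=> // i j ij.
  rewrite !(nth_map_ord (fun i => val (s (f i)))) /=.
  by have /forallP/(_ j)/eqP -> := fs i.
case/subseqP=> b sz_b -> /ordisoP[]; rewrite /word -map_mask size_map.
set p := mask b _ => /eqP sz H; pose f := [ffun i : 'I_k => tnth (Tuple sz) i].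
have sp : sorted (fun i j : 'I_n => i < j) p by apply: sorted_mask (enum_ord_sorted n).
exists f; have fE i x : f i = nth x p i by rewrite ffunE (tnth_nth x).
have pm i j : tau i < tau j -> s (f i) < s (f j).
  move=> ij; have := H i j ij.
  by rewrite !(nth_map (f i)) ?(eqP sz) ?ltn_ord // -!fE.
apply/andP; split; apply/forallP=> i; apply/forallP=> j.
  apply/implyP=> ij; have := sorted_ltn_nth tr (f i) sp (nat_of_ord i) (nat_of_ord j).
  by rewrite !inE (eqP sz) !ltn_ord -!fE; apply.
(* For the converse implication, [tau j <= tau i] splits into equality, which forces [i = j], and
   strict inequality, where [pm] applies. *)
apply/eqP; apply/idP/idP => [|/pm //]; apply: contraTT; rewrite -!leqNgt leq_eqVlt.
case/orP=> [/eqP/val_inj/perm_inj->|/pm/ltnW] //.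
Qed.

Lemma word_inj n : injective (@word n).
Proof.
move=> s1 s2 E; apply/permP=> i; apply: val_inj.
by rewrite -(nth_map_ord (fun i => val (s1 i))) -(nth_map_ord (fun i => val (s2 i))) -!/(word _) E.
Qed.

Lemma word_perm n (s : 'S_n) : perm_eq (word s) (iota 0 n).
Proof.
rewrite -val_enum_ord /word (map_comp val s) perm_map //.
apply: uniq_perm; rewrite ?(map_inj_uniq perm_inj) ?enum_uniq // => i.
by rewrite mem_enum -(permKV s i) map_f ?mem_enum.
Qed.

Lemma word_surj n w : perm_eq w (iota 0 n) -> exists s : 'S_n, word s = w.
Proof.
move=> pw; have szw : size w = n by rewrite (perm_size pw) size_iota.
have ltw (i : 'I_n) : nth 0 w i < n.
  by rewrite -[_ < n](mem_iota 0 n) -(perm_mem pw) mem_nth ?szw.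
have inj : injective (fun i => Ordinal (ltw i)).
  move=> i j [] /eqP; rewrite nth_uniq ?szw // => [/eqP/val_inj //|].
  by rewrite (perm_uniq pw) iota_uniq.
exists (perm inj); apply: (@eq_from_nth _ 0); first by rewrite size_map size_enum_ord.
move=> i; rewrite size_map size_enum_ord => ltin.
by rewrite (nth_map_ord (fun j => val (perm inj j)) (Ordinal ltin)) permE.
Qed.

(** * Cutting a 132-avoider at its maximum *)

Definition av132 (n : nat) : seq (seq nat) :=
  [seq w <- permutations (iota 0 n) | ~~ occurs word132 w].

Lemma mem_av132 n w : (w \in av132 n) = ~~ occurs word132 w && perm_eq w (iota 0 n).
Proof. by rewrite mem_filter mem_permutations. Qed.

Lemma card_avoiders132 k1 k2 (tau1 : 'S_k1) (tau2 : 'S_k2) n :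
  #|avoiders132 tau1 tau2 n| =
  count (fun w => ~~ occurs (ordiso tau1) w && ~~ occurs (ordiso tau2) w) (av132 n).
Proof.
rewrite cardE -(size_map (@word n)) -size_filter; apply: perm_size.
apply: uniq_perm; rewrite ?(map_inj_uniq (@word_inj n)) ?enum_uniq //.
  by rewrite !filter_uniq ?permutations_uniq.
move=> w; rewrite mem_filter mem_av132; apply/mapP/idP => [[s]|].
  rewrite mem_enum inE /avoids !containsE (eq_occurs _ ordiso_132).
  by case/and3P=> aw a1 a2 ->; rewrite aw a1 a2 word_perm.
case/andP=> Hw /andP[aw /word_surj[s Es]]; exists s => //.
by rewrite mem_enum inE /avoids !containsE (eq_occurs _ ordiso_132) Es aw.
Qed.

(** Intended for [d = size v] and [n = size u + size v]: the letters of [u] are lifted above those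
    of [v], and [n] becomes the maximum. *)
Definition splice (d n : nat) (u v : seq nat) : seq nat :=
  map (addn d) u ++ n :: v.

(** Cases on how many letters of an occurrence x y z lie in [u]. All three give an occurrence in
    [u]; none gives one in [v], as the maximum [n] cannot play x. With one or two, x is in [u] and z
    in [v], which contradicts x < z. *)
Lemma occurs132_cat n u v : all (fun x => x < n) v ->
  {in u & v, forall x y, y < x} ->
  ~~ occurs word132 u -> ~~ occurs word132 v -> all (fun x => x < n) u ->
  ~~ occurs word132 (u ++ n :: v).
Proof.
move=> /allP vn uv au av /allP un; apply/negP => /occursP[t st].
case: t st => [|x [|y [|z [|]]]] // st /= /andP[xz zy].
have [t1 [t2 [Et s1 s2]]] := subseq_cat_split st.
have zv z' : z' \in n :: v -> z' < n -> z' \in v by rewrite inE => /predU1P[->|//]; rewrite ltnn.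
have lex z' : z' \in n :: v -> z' <= n by rewrite inE => /predU1P[->|/vn/ltnW].
have h := mem_subseq s1; have h' := mem_subseq s2.
case: t1 Et s1 h => [|a [|b [|c [|]]]] //= Et s1 h.
- have [w1 [w2 [Et2 s3 s4]]] := @subseq_cat_split _ t2 [:: n] v s2.
  case: w1 Et2 s3 => [|a [|b w1]] Et2 s3; move: Et2 => /= Et2; last by have := size_subseq s3.
    by case/negP: av; apply/occursP; exists [:: x; y; z]; [rewrite Et Et2 | rewrite /= xz].
  have := lex y (h' y _); rewrite -Et !inE eqxx orbT => /(_ isT).
  have /= := mem_subseq s3 (mem_head _ _); rewrite inE => /eqP an.
  by move: Et; rewrite Et2 => -[xa _]; rewrite leqNgt -an -xa (ltn_trans xz zy).
- case: Et h' => ? ?; subst a t2 => h'.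
  have zn : z < n by apply: leq_trans zy _; apply: lex; apply: h'; rewrite inE eqxx.
  have := uv x z (h x (mem_head _ _)) (zv z (h' z _) zn).
  by rewrite !inE eqxx orbT => /(_ isT); rewrite ltnNge ltnW.
- case: Et h' => ? ? ?; subst a b t2 => h'.
  have zn : z < n by apply: ltn_trans zy _; apply: un; apply: h; rewrite !inE eqxx orbT.
  have := uv x z (h x (mem_head _ _)) (zv z (h' z (mem_head _ _)) zn).
  by rewrite ltnNge ltnW.
- case: Et s1 => ? ? ? Ett s1; subst a b c.
  by case/negP: au; apply/occursP; exists [:: x; y; z]; rewrite //= xz.
Qed.

(** If x in [u] were at most y in [v], then x n y would be an occurrence of 132; equality is
    excluded because letters do not repeat. *)
Lemma occurs132_desc n u v : uniq (u ++ n :: v) -> all (fun x => x < n) v ->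
  ~~ occurs word132 (u ++ n :: v) -> {in u & v, forall x y, y < x}.
Proof.
move=> Uw /allP vn aw x y xu yv; rewrite ltnNge; apply: contra aw => xy.
apply/occursP; exists [:: x; n; y].
  rewrite -cat1s; apply: cat_subseq; first by rewrite sub1seq.
  by rewrite /= eqxx sub1seq.
rewrite /= vn // andbT ltn_neqAle xy andbT; apply/negP => /eqP Exy.
move: Uw; rewrite cat_uniq => /and3P[_ /hasPn/(_ y) + _].
by rewrite inE yv orbT -Exy xu => /(_ isT).
Qed.

(** The letters of [v] are closed downwards: a letter z <= y with y in [v] cannot lie in [u]. Hence
    [v] contains 0, ..., y for each of its letters y, which gives y < d; counting then gives
    equality. *)
Lemma perm_desc_split d i u v : {in u & v, forall x y, y < x} -> size v = d ->
  perm_eq (u ++ v) (iota 0 (d + i)) -> perm_eq v (iota 0 d) /\ perm_eq u (iota d i).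
Proof.
move=> uv szv pw.
have Uw : uniq (u ++ v) by rewrite (perm_uniq pw) iota_uniq.
have Uv : uniq v by move: Uw; rewrite cat_uniq => /and3P[].
have vd : {subset v <= iota 0 d}.
  move=> y yv; rewrite mem_iota add0n -szv -(size_iota 0 y.+1).
  apply: uniq_leq_size (iota_uniq _ _) _ => z; rewrite mem_iota add0n ltnS /= => zy.
  have : z \in u ++ v.
    have : y \in u ++ v by rewrite mem_cat yv orbT.
    by rewrite !(perm_mem pw) !mem_iota !add0n; apply: leq_ltn_trans.
  by rewrite mem_cat => /orP[/uv/(_ yv)|//]; rewrite ltnNge zy.
have pv : perm_eq v (iota 0 d).
  apply: uniq_perm => //; first exact: iota_uniq.
  by have [_] := uniq_min_size Uv vd (eq_leq (etrans (size_iota 0 d) (esym szv))).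
split=> //; move: pw; rewrite iotaD add0n perm_catC => pvu.
by rewrite -(perm_cat2l v); apply: perm_trans pvu _; rewrite perm_cat2r perm_sym.
Qed.

Lemma word132_addn d t : word132 (map (addn d) t) = word132 t.
Proof. by case: t => [|x [|y [|z [|]]]] //=; rewrite !ltn_add2l. Qed.

Lemma av132_lt n w : w \in av132 n -> all (fun x => x < n) w.
Proof.
rewrite mem_av132 => /andP[_ pw]; apply/allP=> x.
by rewrite (perm_mem pw) mem_iota.
Qed.

Lemma av132_size n w : w \in av132 n -> size w = n.
Proof. by rewrite mem_av132 => /andP[_ /perm_size->]; rewrite size_iota. Qed.

Lemma splice_desc i d u v : u \in av132 i -> v \in av132 d ->
  {in map (addn d) u & v, forall x y, y < x}.
Proof.
move=> _ /av132_lt/allP vd _ y /mapP[x _ ->] yv.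
exact: leq_trans (vd y yv) (leq_addr _ _).
Qed.

Lemma splice_lt i d u v : u \in av132 i -> v \in av132 d ->
  all (fun x => x < i + d) (map (addn d) u) /\ all (fun x => x < i + d) v.
Proof.
move=> /av132_lt/allP ui /av132_lt/allP vd; split; apply/allP => x.
  by case/mapP=> y /ui yi ->; rewrite addnC ltn_add2r.
by move/vd/leq_trans; apply; apply: leq_addl.
Qed.

Lemma iota_rcons n : iota 0 n.+1 = iota 0 n ++ [:: n].
Proof. by rewrite -addn1 iotaD. Qed.

Lemma splice_av132 i d u v : u \in av132 i -> v \in av132 d ->
  splice d (i + d) u v \in av132 (i + d).+1.
Proof.
move=> ui vd; have [un vn] := splice_lt ui vd; have uv := splice_desc ui vd.
move: ui vd; rewrite !mem_av132 => /andP[au pu] /andP[av pv].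
rewrite occurs132_cat //; last by rewrite (occurs_map _ (word132_addn d)).
rewrite andTb /splice -cat1s catA perm_catAC iota_rcons perm_cat2r.
rewrite perm_catC addnC iotaD add0n; apply: perm_cat => //.
by rewrite -[X in iota X](addn0 d) iotaDl perm_map.
Qed.

(** The cut is made at the letter [n]. The left part carries the top [i] letters and is brought down
    by [n - i]. *)
Lemma av132_splice n w : w \in av132 n.+1 -> exists i u v,
  [/\ i <= n, u \in av132 i, v \in av132 (n - i) & w = splice (n - i) n u v].
Proof.
rewrite mem_av132 => /andP[aw pw].
have Uw : uniq w by rewrite (perm_uniq pw) iota_uniq.
have /splitPr Ew : n \in w by rewrite (perm_mem pw) mem_iota /=.
case: Ew pw Uw aw => u' v pw Uw aw; set i := size u'.
have pu'v : perm_eq (u' ++ v) (iota 0 n).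
  move: pw; by rewrite -cat1s catA perm_catAC iota_rcons perm_cat2r.
have szw : i + size v = n by rewrite -size_cat (perm_size pu'v) size_iota.
have vn : all (fun x => x < n) v.
  by apply/allP=> x xv; rewrite -[_ < n](mem_iota 0 n) -(perm_mem pu'v) mem_cat xv orbT.
have uv := occurs132_desc Uw vn aw.
have Ei : n - i = size v by rewrite -szw addKn.
have [pv pu'] : perm_eq v (iota 0 (n - i)) /\ perm_eq u' (iota (n - i) i).
  by apply: perm_desc_split => //; rewrite subnK // -szw leq_addr.
(* Every letter of [u'] is at least [n - i], so this truncated subtraction is undone by adding
   [n - i] back. *)
pose u := map (subn^~ (n - i)) u'.
have Eu : u' = map (addn (n - i)) u.
  rewrite -map_comp map_id_in // => x; rewrite (perm_mem pu') mem_iota => /andP[? _] /=.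
  by rewrite subnKC.
have au : ~~ occurs word132 u'.
  by apply: contra aw; apply: occurs_subseq; apply: prefix_subseq.
exists i, u, v; split; rewrite ?mem_av132 //.
- by rewrite -szw leq_addr.
- rewrite -(occurs_map _ (word132_addn (n - i))) -Eu au /=.
  apply: (@perm_map_inj _ _ (addn (n - i))); first exact: addnI.
  by rewrite -Eu -iotaDl addn0.
- rewrite pv andbT; apply: contra aw; apply: occurs_subseq.
  by apply: subseq_trans (suffix_subseq _ _); apply: subseq_cons.
- by rewrite /splice -Eu.
Qed.

(** The length [i] is recovered as the index of [n], all letters of the lifted left part being
    smaller; [take] and [drop] then recover both parts. *)
Lemma splice_inj n i j u v u' v' : i <= n -> j <= n ->
    u \in av132 i -> v \in av132 (n - i) -> u' \in av132 j -> v' \in av132 (n - j) ->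
  splice (n - i) n u v = splice (n - j) n u' v' -> [/\ i = j, u = u' & v = v'].
Proof.
move=> lein lejn ui vi uj vj E.
have idx k a b : k <= n -> a \in av132 k -> b \in av132 (n - k) ->
    index n (splice (n - k) n a b) = k.
  move=> lekn ak bk; have [+ _] := splice_lt ak bk; rewrite subnKC // => /allP alt.
  rewrite index_cat ifN; last by apply/negP => /alt; rewrite ltnn.
  by rewrite /= eqxx addn0 size_map (av132_size ak).
have Eij : i = j by rewrite -(idx i u v) // E idx.
subst j; split=> //.
  move/(congr1 (take i)): E; rewrite !take_size_cat ?size_map ?(av132_size ui) ?(av132_size uj) //.
  exact: (inj_map (@addnI _)).
by move/(congr1 (drop i)): E; rewrite !drop_size_cat ?size_map ?(av132_size ui) ?(av132_size uj) //
  => -[].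
Qed.

(** * Increasing and rotated patterns across the cut *)

Lemma incr_map_addn d l t : incr l (map (addn d) t) = incr l t.
Proof.
rewrite /incr size_map sorted_map; congr (_ && _).
by apply: eq_sorted => x y /=; rewrite ltn_add2l.
Qed.

Lemma rotinc_map_addn d a m t : rotinc a m (map (addn d) t) = rotinc a m t.
Proof.
rewrite /rotinc size_map -map_take -map_drop !sorted_map allrel_mapl allrel_mapr.
have lt x y : (d + x < d + y) = (x < y) by rewrite ltn_add2l.
rewrite !(eq_sorted (e' := ltn)) => [|x y|x y]; try exact: lt.
by congr [&& _, _, _ & _]; apply: eq_allrel => x y; apply: lt.
Qed.

Lemma take_incr l j t : j <= l -> incr l t -> incr j (take j t).
Proof.
move=> lejl /andP[/eqP szt st]; rewrite /incr size_takel ?szt ?eqxx //.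
exact: subseq_sorted ltn_trans _ _ (take_subseq _ _) st.
Qed.

Lemma occurs_incr_leq l j w : j <= l -> occurs (incr l) w -> occurs (incr j) w.
Proof.
move=> lejl /occursP[t stw it]; apply/occursP; exists (take j t).
  exact: subseq_trans (take_subseq _ _) stw.
exact: take_incr it.
Qed.

Lemma occurs_rotinc_incr a m w : occurs (rotinc a m) w -> occurs (incr a) w.
Proof.
case/occursP=> t stw /and4P[/eqP szt st _ _]; apply/occursP; exists (take a t).
  exact: subseq_trans (take_subseq _ _) stw.
by rewrite /incr st size_takel ?eqxx // szt leq_addr.
Qed.

(** Otherwise the heads of the two parts would be ordered both ways. This is applied to each
    increasing block that might straddle the cut. *)
Lemma sorted_desc_nil s t : sorted ltn (s ++ t) -> {in s & t, forall x y, y < x} ->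
  s = [::] \/ t = [::].
Proof.
case: s => [|x s]; first by left.
case: t => [|y t]; first by right.
rewrite (sorted_pairwise ltn_trans) pairwise_cat => /and3P[+ _ _] H.
move=> /allrelP/(_ x y (mem_head _ _) (mem_head _ _)) xy.
by have := H x y (mem_head _ _) (mem_head _ _); rewrite ltnNge ltnW.
Qed.

Section Cut.

Variables (n : nat) (u v : seq nat).
Hypothesis un : all (fun x => x < n) u.
Hypothesis vn : all (fun x => x < n) v.
Hypothesis uv : {in u & v, forall x y, y < x}.

Lemma subseq_rcons_split t : subseq t (rcons u n) ->
  subseq t u \/ exists2 s, t = rcons s n & subseq s u.
Proof.
rewrite -cats1 => /subseq_cat_split[s [r [-> su]]].
case: r => [|x [|y r]]; first by rewrite cats0; left.
  by rewrite sub1seq inE => /eqP->; right; exists s; rewrite ?cats1.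
by move/size_subseq.
Qed.

(** Attaching [n] to [u] keeps the descent towards [v], so only two sides of the cut need to be
    considered. *)
Lemma rcons_desc : {in rcons u n & v, forall x y, y < x}.
Proof.
move=> x y; rewrite mem_rcons inE => /predU1P[->|/uv] //; last by apply.
exact: (allP vn).
Qed.

(** The maximum [n] extends any increasing subsequence of [u]; conversely, removing the last letter
    of one in [rcons u n] leaves one in [u]. *)
Lemma occurs_incr_rcons l : occurs (incr l.+1) (rcons u n) = occurs (incr l) u.
Proof.
apply/occursP/occursP => -[t].
  case/subseq_rcons_split => [tu it|[s -> su]].
    exists (take l t); last by apply: take_incr it.
    exact: subseq_trans (take_subseq _ _) tu.
  rewrite /incr size_rcons eqSS => /andP[szs ss]; exists s => //.
  by rewrite szs; apply: subseq_sorted ltn_trans _ _ (subseq_rcons _ _) ss.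
move=> tu /andP[szt st]; exists (rcons t n).
  by rewrite -!cats1 cat_subseq.
rewrite /incr size_rcons eqSS szt -cats1 (sorted_pairwise ltn_trans) pairwise_cat.
rewrite -(sorted_pairwise ltn_trans) st allrel1r /= !andbT.
by apply/allP => x /(mem_subseq tu)/(allP un).
Qed.

Lemma occurs_incr_cut l :
  occurs (incr l.+1) (u ++ n :: v) = occurs (incr l) u || occurs (incr l.+1) v.
Proof.
rewrite -cat_rcons -occurs_incr_rcons; apply/idP/orP; last first.
  by case; apply: occurs_subseq; rewrite ?prefix_subseq ?suffix_subseq.
case/occursP=> _ /subseq_cat_split[t1 [t2 [-> s1 s2]]] /andP[sz st].
have := sorted_desc_nil st (sub_in11 (mem_subseq s1) (mem_subseq s2) rcons_desc).
case=> E; move: sz st; rewrite E ?cats0 => sz st; [right | left]; apply/occursP.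
  by exists t2; rewrite // /incr sz.
by exists t1; rewrite // /incr sz.
Qed.

(* Both blocks of the pattern are increasing while letters decrease across the
   cut, so a cut meeting both parts must separate the two blocks exactly. *)
Lemma occurs_rotinc_cut a m : occurs (rotinc a.+1 m.+1) (u ++ n :: v) =
  [|| occurs (rotinc a.+1 m.+1) u, occurs (rotinc a.+1 m.+1) v
    | occurs (incr a) u && occurs (incr m.+1) v].
Proof.
(* With [n] attached to [u], the third alternative asks for a full first block, of length [a + 1],
   to the left of the cut. *)
rewrite -occurs_incr_rcons; apply/idP/or3P; last first.
  case; first by apply: occurs_subseq; apply: prefix_subseq.
    by rewrite -cat_rcons; apply: occurs_subseq; apply: suffix_subseq.
  case/andP=> /occursP[t1 s1 /andP[/eqP sz1 st1]] /occursP[t2 s2 /andP[/eqP sz2 st2]].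
  rewrite -cat_rcons; apply/occursP; exists (t1 ++ t2); first exact: cat_subseq.
  rewrite /rotinc size_cat sz1 sz2 eqxx take_size_cat // drop_size_cat // st1 st2.
  by apply/allrelP => x y xt yt; apply: rcons_desc; [apply: mem_subseq xt | apply: mem_subseq yt].
rewrite -cat_rcons => /occursP[t].
case/subseq_cat_split=> t1 [t2 [Et s1 s2]] rt; case/and4P: (rt) => /eqP szt stA stB AB.
have t12 : {in t1 & t2, forall x y, y < x}.
  by move=> x y xt yt; apply: rcons_desc; [apply: mem_subseq xt | apply: mem_subseq yt].
have szt12 : size t1 + size t2 = a.+1 + m.+1 by rewrite -szt Et size_cat.
have in_v : t1 = [::] -> occurs (rotinc a.+1 m.+1) v.
  by move=> E; apply/occursP; exists t2 => //; move: rt; rewrite Et E.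
(* An occurrence inside [rcons u n] cannot use [n]: as last letter it would belong to the nonempty
   second block, yet no letter of the first block exceeds it. *)
have in_u : t2 = [::] -> occurs (rotinc a.+1 m.+1) u.
  move=> E; have Et1 : t = t1 by rewrite Et E cats0.
  rewrite -Et1 in s1; case/subseq_rcons_split: (s1) => [su|[s Es su]].
    by apply/occursP; exists t.
  have szs : size s = a.+1 + m by apply: succn_inj; rewrite -(size_rcons s n) -Es szt addnS.
  have ns : n \in drop a.+1 t.
    rewrite Es -cats1 drop_cat szs; case: ltnP => _; first by rewrite mem_cat mem_head orbT.
    by rewrite subnDA subnn sub0n drop0 mem_head.
  have xs : nth 0 t 0 \in take a.+1 t.
    by rewrite -(nth_take 0 (ltn0Sn a)) mem_nth // size_takel // szt leq_addr.
  have := allrelP AB _ _ xs ns; rewrite ltnNge.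
  have := mem_subseq s1 (mem_take xs); rewrite mem_rcons inE.
  by case/predU1P=> [->|/(allP un)/ltnW ->]; rewrite ?leqnn.
(* If [t1] is shorter than the first block, that block meets both sides unless [t1] is empty; if
   longer, the second block does unless [t2] is empty. With equal lengths the cut separates the
   blocks. *)
have [lt1|lt1|eq1] := ltngtP (size t1) a.+1.
- have : take a.+1 t = t1 ++ take (a.+1 - size t1) t2.
    by rewrite Et take_cat ltnNge ltnW.
  move=> EA; rewrite EA in stA.
  case: (sorted_desc_nil stA) => [x y xt /mem_take yt|/in_v ? |E]; first exact: t12.
    by constructor 2.
  suff : 0 < size (take (a.+1 - size t1) t2) by rewrite E.
  by rewrite size_takel ?subn_gt0 // leq_subLR szt12 leq_addr.
- have EB : drop a.+1 t = drop a.+1 t1 ++ t2 by rewrite Et drop_cat lt1.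
  rewrite EB in stB.
  case: (sorted_desc_nil stB) => [x y /mem_drop xt yt|E|/in_u ?]; first exact: t12.
    suff : 0 < size (drop a.+1 t1) by rewrite E.
    by rewrite size_drop subn_gt0.
  by constructor 1.
- constructor 3; move: stA stB; rewrite Et take_size_cat // drop_size_cat // => st1 st2.
  apply/andP; split; apply/occursP; [exists t1 | exists t2] => //.
    by rewrite /incr eq1 eqxx.
  by rewrite /incr st2 andbT -(eqn_add2l a.+1) -{1}eq1 szt12.
Qed.

End Cut.

Local Open Scope ring_scope.

(** * Expansions of rational functions *)

(** The Cauchy product of two power series given by their coefficients. *)
Definition conv (a b : nat -> rat) (n : nat) : rat :=
  \sum_(i < n.+1) a i * b (n - i)%N.

Lemma eq_conv (a a' b b' : nat -> rat) :
  a =1 a' -> b =1 b' -> conv a b =1 conv a' b'.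
Proof. by move=> Ea Eb n; apply: eq_bigr => i _; rewrite Ea Eb. Qed.

(** Low coefficients depend only on truncations, so commutativity and associativity of [conv] can be
    inherited from polynomials. *)
Lemma conv_trunc N a b n : (n < N)%N ->
  (\poly_(i < N) a i * \poly_(i < N) b i)`_n = conv a b n.
Proof.
move=> ltnN; rewrite coefM; apply: eq_bigr => i _; rewrite !coef_poly.
have -> : (i < N)%N by apply: leq_trans ltnN; apply: ltn_ord.
by have -> : (n - i < N)%N by apply: leq_ltn_trans ltnN; apply: leq_subr.
Qed.

Lemma conv_coef (p q : {poly rat}) : conv (nth 0 p) (nth 0 q) =1 nth 0 (p * q).
Proof. by move=> n; rewrite coefM. Qed.

Lemma convC a b : conv a b =1 conv b a.
Proof. by move=> n; rewrite -!(conv_trunc _ _ (ltnSn n)) mulrC. Qed.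

Lemma convA a b c : conv a (conv b c) =1 conv (conv a b) c.
Proof.
move=> n; pose T (f : nat -> rat) := \poly_(i < n.+1) f i.
have TE f i : (i <= n)%N -> (T f)`_i = f i by rewrite coef_poly ltnS => ->.
transitivity ((T a * (T b * T c))`_n).
  rewrite coefM; apply: eq_bigr => i _.
  by rewrite TE -1?ltnS // conv_trunc // ltnS leq_subr.
rewrite mulrA coefM; apply: eq_bigr => i _.
by rewrite TE ?leq_subr // conv_trunc.
Qed.

Lemma convDl a b c n : conv (fun i => a i + b i) c n = conv a c n + conv b c n.
Proof. by rewrite -big_split; apply: eq_bigr => i _; rewrite mulrDl. Qed.

Lemma convNl a c n : conv (fun i => - a i) c n = - conv a c n.
Proof. by rewrite -sumrN; apply: eq_bigr => i _; rewrite mulNr. Qed.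

Lemma convDr a b c n : conv c (fun i => a i + b i) n = conv c a n + conv c b n.
Proof. by rewrite convC convDl ![conv c _ n]convC. Qed.

Lemma convNr a c n : conv c (fun i => - a i) n = - conv c a n.
Proof. by rewrite convC convNl convC. Qed.

Lemma convMl (p q : {poly rat}) a :
  conv (nth 0 (p * q)) a =1 conv (nth 0 p) (conv (nth 0 q) a).
Proof. by move=> n; rewrite convA; apply: eq_conv => // i; rewrite conv_coef. Qed.

Lemma conv1 a : conv (nth 0 (1 : {poly rat})) a =1 a.
Proof.
move=> n; rewrite /conv big_ord_recl coef1 mul1r subn0 big1 ?addr0 // => i _.
by rewrite coef1 mul0r.
Qed.

Lemma convX0 a : conv (nth 0 ('X : {poly rat})) a 0 = 0.
Proof. by rewrite /conv big_ord1 coefX mul0r. Qed.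

Lemma convXS a n : conv (nth 0 ('X : {poly rat})) a n.+1 = a n.
Proof.
rewrite /conv !big_ord_recl !coefX /= mul0r add0r mul1r subSS subn0 big1 ?addr0 //.
by move=> i _; rewrite coefX mul0r.
Qed.

Local Notation polyQx p := (polyQ p varx).

Lemma polyQxD p q : polyQx (p + q) = polyQx p + polyQx q.
Proof. by rewrite !polyQxE comp_polyD tofracD. Qed.

Lemma polyQxN p : polyQx (- p) = - polyQx p.
Proof. by rewrite !polyQxE -sub0r comp_polyB comp_poly0 sub0r tofracN. Qed.

Lemma polyQxM p q : polyQx (p * q) = polyQx p * polyQx q.
Proof. by rewrite !polyQxE comp_polyM tofracM. Qed.

Lemma polyQx1 : polyQx 1 = 1.
Proof. by rewrite polyQxE comp_polyC. Qed.

Lemma polyQxX : polyQx 'X = varx.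
Proof. by rewrite polyQxE comp_polyX tofracXn. Qed.

Lemma polyQx_neq0 p : p.[0] != 0 -> polyQx p != 0.
Proof.
move=> p0; rewrite polyQxE tofrac_eq0; apply: contra_neq p0 => p0.
have := congr1 (fun w : {poly rat} => w.[0]) p0.
by rewrite horner_comp hornerXn expr0n horner0.
Qed.

Lemma eq_has_expansion a b r s : a =1 b -> r = s ->
  has_expansion a r -> has_expansion b s.
Proof.
move=> Eab <- [p [q [q0 rE qa]]]; exists p, q; split=> // n.
by rewrite -qa; apply: eq_bigr => i _; rewrite Eab.
Qed.

Lemma has_expansion_poly (p : {poly rat}) : has_expansion (nth 0 p) (polyQx p).
Proof.
exists p, 1; split; first by rewrite hornerC oner_eq0.
  by rewrite polyQx1 divr1.
by move=> n; apply: conv1.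
Qed.

Lemma has_expansionD a b r s : has_expansion a r -> has_expansion b s ->
  has_expansion (fun n => a n + b n) (r + s).
Proof.
move=> [p [q [q0 -> qa]]] [p' [q' [q'0 -> qb]]].
have {}qa : conv (nth 0 q) a =1 nth 0 p := qa.
have {}qb : conv (nth 0 q') b =1 nth 0 p' := qb.
exists (p * q' + p' * q), (q * q'); split.
- by rewrite hornerM mulf_neq0.
- rewrite polyQxD !polyQxM.
  by rewrite addf_div ?polyQx_neq0.
- move=> n; rewrite -[LHS]/(conv (nth 0 (q * q')) (fun i => a i + b i) n) convDr.
  rewrite (convMl _ _ b) (eq_conv (fun=> erefl) qb) conv_coef [q * q']mulrC.
  rewrite convMl (eq_conv (fun=> erefl) qa) conv_coef.
  by rewrite -coefD [q' * p]mulrC [q * p']mulrC.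
Qed.

Lemma has_expansionN a r : has_expansion a r -> has_expansion (fun n => - a n) (- r).
Proof.
move=> [p [q [q0 -> qa]]]; exists (- p), q; split=> //.
  by rewrite polyQxN mulNr.
by move=> n; rewrite -[LHS]/(conv (nth 0 q) (fun i => - a i) n) convNr coefN -qa.
Qed.

Lemma has_expansionM a b r s : has_expansion a r -> has_expansion b s ->
  has_expansion (conv a b) (r * s).
Proof.
move=> [p [q [q0 -> qa]]] [p' [q' [q'0 -> qb]]].
have {}qa : conv (nth 0 q) a =1 nth 0 p := qa.
have {}qb : conv (nth 0 q') b =1 nth 0 p' := qb.
exists (p * p'), (q * q'); split.
- by rewrite hornerM mulf_neq0.
- by rewrite !polyQxM mulf_div.
- move=> n; rewrite -[LHS]/(conv (nth 0 (q * q')) (conv a b) n) [q * q']mulrC convMl.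
  rewrite (eq_conv (fun=> erefl) (convA _ _ _)).
  rewrite (eq_conv (fun=> erefl) (eq_conv qa (fun=> erefl))).
  rewrite (eq_conv (fun=> erefl) (convC _ _)) convA (eq_conv qb (fun=> erefl)).
  by rewrite conv_coef mulrC.
Qed.

(* Clearing the denominators q of b and q' of c turns the equation into
   (q q' - X q p') a = q' p. *)
Lemma has_expansion_fix a b c r s : has_expansion b r -> has_expansion c s ->
    (forall n, a n = b n + conv (nth 0 'X) (conv c a) n) ->
  has_expansion a (r / (1 - varx * s)).
Proof.
move=> [p [q [q0 -> qb]]] [p' [q' [q'0 -> qc]]] Ea.
have {}qb : conv (nth 0 q) b =1 nth 0 p := qb.
have {}qc : conv (nth 0 q') c =1 nth 0 p' := qc.
exists (q' * p), (q * q' - 'X * q * p'); split.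
- by rewrite !(hornerM, hornerD, hornerN, hornerX) !mul0r subr0 mulf_neq0.
- rewrite polyQxD polyQxN !polyQxM polyQxX.
  have nq := polyQx_neq0 q0; have nq' := polyQx_neq0 q'0.
  rewrite -[1 in LHS](divff nq') mulrA -mulrBl invf_div mulf_div.
  by rewrite [polyQx p * _]mulrC mulrBr mulrCA mulrA.
- move=> n; rewrite -[LHS]/(conv (nth 0 (q * q' - 'X * q * p')) a n).
  have -> : conv (nth 0 (q * q' - 'X * q * p')) a n =
            conv (nth 0 (q * q')) a n - conv (nth 0 ('X * q * p')) a n.
    by rewrite -convNl -convDl; apply: eq_conv => // i; rewrite coefB.
  rewrite [X in X - _](eq_conv (fun=> erefl) Ea) convDr.
  rewrite [q * q']mulrC (convMl _ _ b) (eq_conv (fun=> erefl) qb) conv_coef.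
  (* Since [q'] times [c] is [p'], the contribution of [X c a] is exactly the term subtracted in the
     new denominator, and the two cancel. *)
  suff -> : conv (nth 0 (q' * q)) (conv (nth 0 'X) (conv c a)) n =
            conv (nth 0 ('X * q * p')) a n by rewrite addrK.
  have E : q' * q * 'X = 'X * q * q' by ring.
  rewrite -convMl E convMl [RHS]convMl.
  apply: eq_conv => // i; rewrite convA.
  by apply: eq_conv => // j; apply: qc.
Qed.

(** * Chebyshev polynomials and the continued fractions $R_k$ *)

(* U_r(t) = S_r(x) / sqrt(x)^r, see polyQ_chebU. *)
Fixpoint chebS (r : nat) : {poly rat} :=
  match r with
  | 0 => 1
  | 1 => 1
  | (r2.+1 as r1).+1 => chebS r1 - 'X * chebS r2
  end.

Lemma chebSSS r : chebS r.+2 = chebS r.+1 - 'X * chebS r.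
Proof. by []. Qed.

(** The addition formula $U_{i+j+2}=U_{i+1}U_{j+1}-U_iU_j$ after rescaling by powers of $\sqrt
    x$. *)
Lemma chebS_add i j :
  chebS (i + j).+2 = chebS i.+1 * chebS j.+1 - 'X * chebS i * chebS j.
Proof.
elim: i j => [|i IH] j; first by rewrite add0n chebSSS mul1r mulr1.
by rewrite addSnnS IH !chebSSS; ring.
Qed.

(** Each [chebS r] has constant term 1, since the recursion subtracts a multiple of ['X]. *)
Lemma polyQx_chebS_neq0 r : polyQx (chebS r) != 0.
Proof.
apply: polyQx_neq0; suff: (chebS r).[0] = 1 /\ (chebS r.+1).[0] = 1.
  by case=> -> _; apply: oner_neq0.
elim: r => [|r [IH1 IH2]]; first by rewrite !hornerE.
by split=> //; rewrite chebSSS hornerD hornerN hornerM hornerX mul0r subr0.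
Qed.

Lemma sqrtx_neq0 : sqrtx != 0.
Proof. by rewrite tofrac_eq0 polyX_eq0. Qed.

Lemma two_neq0 : 2 != 0 :> Qsqrtx.
Proof.
have -> : 2 = tofrac (2%:R : rat)%:P :> Qsqrtx by rewrite !rmorph_nat.
by rewrite tofrac_eq0 polyC_eq0.
Qed.

Lemma polyQ_chebU r : sqrtx ^+ r * polyQ (chebU r) vart = polyQx (chebS r).
Proof.
have QE p y : polyQ p y = (map_poly (@tofrac {poly rat} \o polyC) p).[y] by [].
(* The recursion has order two, so two consecutive indices are carried through the induction;
   $2t\sqrt x=1$ turns one recursion into the other. *)
suff: sqrtx ^+ r * polyQ (chebU r) vart = polyQx (chebS r) /\
      sqrtx ^+ r.+1 * polyQ (chebU r.+1) vart = polyQx (chebS r.+1) by case.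
have t2 : sqrtx * (2 * vart) = 1.
  rewrite mulrCA mulrA; apply: mulfV; apply: mulf_neq0.
    exact: two_neq0.
  exact: sqrtx_neq0.
have Q2X : polyQ (2 *: 'X) vart = 2 * vart.
  rewrite QE map_polyZ map_polyX hornerZ hornerX /=.
  by rewrite !rmorph_nat.
elim: r => [|r [IH1 IH2]].
  by rewrite polyQx1 {1}QE rmorph1 hornerC mul1r [chebU 1]/= Q2X expr1 t2.
have -> : polyQ (chebU r.+2) vart =
    2 * vart * polyQ (chebU r.+1) vart - polyQ (chebU r) vart.
  by rewrite -Q2X !QE -hornerM -hornerN -hornerD -rmorphM -rmorphB.
split=> //; rewrite chebSSS polyQxD polyQxN polyQxM polyQxX -IH1 -IH2 /varx.
move: (polyQ _ vart) (polyQ _ vart) t2 => v u; move: sqrtx vart => x t xt1.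
have -> : x ^+ r.+2 * (2 * t * u - v) =
    x * (2 * t) * (x ^+ r.+1 * u) - x ^+ 2 * (x ^+ r * v) by rewrite !exprS; ring.
by rewrite xt1 mul1r.
Qed.

(** This is $R_k=S_{k-1}/S_k$, free of $\sqrt x$. The value 0 at [k = 0] starts the recursion
    $R_{k+1}=1/(1-xR_k)$ and matches the count of words without an increasing subsequence of length
    0, of which there are none. *)
Definition contfrac (k : nat) : Qsqrtx :=
  if k is j.+1 then polyQx (chebS j) / polyQx (chebS k) else 0.

Lemma R_contfrac k : (0 < k)%N -> R_ k = contfrac k.
Proof.
have aux (F : fieldType) (x u v : F) j : 2 != 0 :> F -> x != 0 -> v != 0 ->
    2 * (2 * x)^-1 * u / v = (x ^+ j * u) / (x ^+ j.+1 * v).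
  by move=> n2 x0 v0; rewrite exprS; field; rewrite v0 x0 n2 expf_neq0.
case: k => // k _; rewrite /R_ /contfrac -!polyQ_chebU /vart.
apply: aux; first exact: two_neq0; first exact: sqrtx_neq0.
have := polyQx_chebS_neq0 k.+1.
by rewrite -polyQ_chebU mulf_eq0 negb_or => /andP[].
Qed.

(** This is $S_{k+1}=S_k-xS_{k-1}$ divided by $S_k$. *)
Lemma contfracS k : contfrac k.+1 = 1 / (1 - varx * contfrac k).
Proof.
have aux (F : fieldType) (x u v : F) : v != 0 -> v - x * u != 0 ->
    v / (v - x * u) = 1 / (1 - x * (u / v)).
  by move=> v0 w0; field; rewrite v0.
case: k => [|k]; first by rewrite /contfrac mulr0 subr0 polyQx1.
have := polyQx_chebS_neq0 k.+2.
rewrite /contfrac chebSSS polyQxD polyQxN polyQxM polyQxX => n2.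
by apply: aux n2; apply: polyQx_chebS_neq0.
Qed.

(** With $k=a+m+2$, the addition formula turns the two parentheses into $S_k/(S_{a+1}S_{m+1})$ and
    $S_{k-1}/(S_aS_{m+1})$, so both sides equal $S_{k-1}/(S_{a+1}S_{m+1})$. This makes $R_k$ the
    fixed point of the affine recursion. *)
Lemma contfrac_fix a m :
  contfrac (a.+1 + m.+1) * (1 - varx * contfrac m.+1 * contfrac a.+1) =
  contfrac a.+1 * (1 - varx * contfrac a * contfrac m.+1).
Proof.
have aux (F : fieldType) (x s1 s2 a1 a2 b0 b1 b2 : F) :
    s1 != 0 -> s2 != 0 -> a1 != 0 -> a2 != 0 -> b1 != 0 -> b2 != 0 ->
    s2 = b2 * a2 - x * b1 * a1 -> s1 = b2 * a1 - x * b1 * b0 ->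
  s1 / s2 * (1 - x * (b1 / b2) * (a1 / a2)) = a1 / a2 * (1 - x * (b0 / a1) * (b1 / b2)).
  move=> ns1 ns2 na1 na2 nb1 nb2 E2 E1.
  have -> : 1 - x * (b1 / b2) * (a1 / a2) = s2 / (b2 * a2).
    by rewrite E2; field; rewrite na2.
  have -> : 1 - x * (b0 / a1) * (b1 / b2) = s1 / (b2 * a1).
    by rewrite E1; field; rewrite na1.
  by field; rewrite ?ns2 ?na1 ?na2 ?nb2.
have nz := polyQx_chebS_neq0.
rewrite addSn addnS.
(* The numerator is $S_{a-1}$ with the convention $S_{-1}=0$, so that [a = 0] fits the same
   identity. *)
have -> : contfrac a = (if a is j.+1 then polyQx (chebS j) else 0) / polyQx (chebS a).
  by case: a => [|a] //=; rewrite mul0r.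
rewrite /contfrac; apply: aux; rewrite ?nz //.
  by rewrite addnC chebS_add polyQxD polyQxN !polyQxM polyQxX.
case: a => [|a]; first by rewrite add0n mulr0 subr0 polyQx1 mulr1.
by rewrite addSn addnC chebS_add polyQxD polyQxN !polyQxM polyQxX.
Qed.

(** Dividing by $1-xR_a$ is multiplying by $R_{a+1}$. As [r] is fixed by this affine map, only the
    deviation [P ^+ e * D] changes, by the factor [P]. *)
Lemma contfrac_step a m e (r := contfrac (a.+1 + m.+1))
    (P := varx * contfrac a.+1 * contfrac m.+1) (D := r - contfrac a.+1) :
  (1 - varx * (contfrac a * contfrac m.+1)
     + varx * (contfrac m.+1 * (r - P ^+ e * D))) / (1 - varx * contfrac a) =
  r - P ^+ e.+1 * D.
Proof.
have := contfrac_fix a m; rewrite -/r exprS.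
rewrite -[(1 - varx * contfrac a)^-1]div1r -contfracS /D /P.
move: (contfrac a) (contfrac a.+1) (contfrac m.+1) varx (_ ^+ e) => A B M x E fixE.
have -> : (1 - x * (A * M) + x * (M * (r - E * (r - B)))) * B =
          B * (1 - x * A * M) + r * (x * M * B) - x * B * M * E * (r - B) by ring.
by rewrite -fixE; ring.
Qed.

(** * The recursions *)

Definition tot (f : seq nat -> rat) (n : nat) : rat := \sum_(w <- av132 n) f w.

Lemma tot0 f : tot f 0 = f [::].
Proof. by rewrite /tot /av132 /= occurs_nil big_seq1. Qed.

Lemma uniq_av132 n : uniq (av132 n).
Proof. by rewrite filter_uniq ?permutations_uniq. Qed.

(** For [i] from 0 to [n], [splice] is a bijection from the pairs of 132-avoiders of sizes [i] and
    [n - i] onto those of size [n + 1]. *)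
Lemma tot_rec f n : tot f n.+1 =
  \sum_(i < n.+1) \sum_(u <- av132 i) \sum_(v <- av132 (n - i)) f (splice (n - i) n u v).
Proof.
pose pairs i := [seq (u, v) | u <- av132 i, v <- av132 (n - i)].
have memP i p : p \in pairs i -> p.1 \in av132 i /\ p.2 \in av132 (n - i).
  by case: p => u v /allpairsP[[u' v'] [/= ? ? [-> ->]]].
rewrite /tot (perm_big [seq splice (n - i) n p.1 p.2 | i <- iota 0 n.+1, p <- pairs i]).
  rewrite big_allpairs_dep -{1}[n.+1]subn0 -/(index_iota _ _) big_mkord.
  by apply: eq_bigr => i _; rewrite /pairs big_allpairs_dep.
apply: uniq_perm; first exact: uniq_av132.
  apply: allpairs_uniq_dep; first exact: iota_uniq.
    move=> i _; apply: allpairs_uniq; rewrite ?uniq_av132 // => -[a b] [c d] _ _ [-> ->] //.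
  move=> p q /flatten_mapP[i + /mapP[[u v] /memP[ui vi] ->]].
  move=> + /flatten_mapP[j + /mapP[[u' v'] /memP[uj vj] ->]].
  rewrite !mem_iota !ltnS => lein lejn.
  by case/(@splice_inj n i j u v u' v' lein lejn ui vi uj vj) => -> -> ->.
move=> w; apply/idP/allpairsPdep => [/av132_splice[i [u [v [lein ui vi ->]]]]|].
  exists i, (u, v); rewrite mem_iota ltnS lein; split=> //.
  by apply/allpairsP; exists (u, v).
case=> i [p []]; rewrite mem_iota ltnS => lein /memP[ui vi] ->.
by have := splice_av132 ui vi; rewrite subnKC.
Qed.

Lemma splice_incr i d l u v : u \in av132 i -> v \in av132 d ->
  occurs (incr l.+1) (splice d (i + d) u v) =
  occurs (incr l) u || occurs (incr l.+1) v.
Proof.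
move=> ui vd; have [un vn] := splice_lt ui vd.
by rewrite occurs_incr_cut ?(occurs_map _ (incr_map_addn _ _)) //; apply: splice_desc ui vd.
Qed.

Lemma splice_rotinc i d a m u v : u \in av132 i -> v \in av132 d ->
  occurs (rotinc a.+1 m.+1) (splice d (i + d) u v) =
  [|| occurs (rotinc a.+1 m.+1) u, occurs (rotinc a.+1 m.+1) v
    | occurs (incr a) u && occurs (incr m.+1) v].
Proof.
move=> ui vd; have [un vn] := splice_lt ui vd.
rewrite occurs_rotinc_cut ?(occurs_map _ (incr_map_addn _ _)) //; last exact: splice_desc ui vd.
by rewrite (occurs_map _ (rotinc_map_addn _ _ _)).
Qed.

Lemma sum_splice_conv g h n :
  \sum_(i < n.+1) \sum_(u <- av132 i) \sum_(v <- av132 (n - i)) g u * h v =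
  conv (tot g) (tot h) n.
Proof. by apply: eq_bigr => i _; rewrite big_distrlr. Qed.

Definition noincr (l : nat) (w : seq nat) : rat := (~~ occurs (incr l) w)%:R.

Definition norotincr (a m l : nat) (w : seq nat) : rat :=
  (~~ occurs (rotinc a m) w && ~~ occurs (incr l) w)%:R.

Lemma tot_noincr0 n : tot (noincr 0) n = 0.
Proof.
apply: big1 => w _; rewrite /noincr (_ : occurs _ w) //.
by apply/occursP; exists [::]; rewrite ?sub0seq.
Qed.

(** The maximum lengthens increasing subsequences on the left only, and none crosses the cut, so the
    indicator factors into length [l] for u and [l + 1] for v. *)
Lemma tot_noincrS l n : tot (noincr l.+1) n =
  nth 0 (1 : {poly rat}) n
  + conv (nth 0 ('X : {poly rat})) (conv (tot (noincr l)) (tot (noincr l.+1))) n.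
Proof.
case: n => [|n]; first by rewrite tot0 convX0 coef1 /noincr occurs_nil addr0.
rewrite convXS coef1 add0r tot_rec -sum_splice_conv.
apply: eq_bigr => i _; rewrite !big_seq; apply: eq_bigr => u ui.
rewrite !big_seq; apply: eq_bigr => v vi.
have lein : (i <= n)%N by exact: ltn_ord i.
have := splice_incr l ui vi; rewrite subnKC // /noincr => ->.
by rewrite negb_or -natrM mulnb.
Qed.

(** The first block of the rotated pattern is already an increasing subsequence of length [a]. *)
Lemma tot_norotincr_base a m n : tot (norotincr a m a) n = tot (noincr a) n.
Proof.
apply: eq_bigr => w _; rewrite /norotincr /noincr andbC.
case: (boolP (occurs (incr a) w)) => //= na.
by rewrite (contra (@occurs_rotinc_incr a m w) na).
Qed.

(* Inclusion-exclusion on two conditions, one of which must hold: the left side of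
   the cut has no increasing subsequence of length a, or the right side none of
   length m + 1. *)
Lemma tot_norotincrS a m l n : (m <= a <= l)%N -> tot (norotincr a.+1 m.+1 l.+1) n =
  nth 0 (1 : {poly rat}) n
  - conv (nth 0 ('X : {poly rat})) (conv (tot (noincr a)) (tot (noincr m.+1))) n
  + conv (nth 0 ('X : {poly rat})) (conv (tot (noincr m.+1)) (tot (norotincr a.+1 m.+1 l))) n
  + conv (nth 0 ('X : {poly rat})) (conv (tot (noincr a)) (tot (norotincr a.+1 m.+1 l.+1))) n.
Proof.
case/andP=> lema leal.
(* The letters I and J stand for occurrences in u and in v: [Iu], [Jv] of the rotated pattern, [Ia],
   [Jm] of increasing words of lengths [a] and [m + 1], [Il], [Jl] of lengths [l] and [l + 1]. The
   four implications hold because [m <= a <= l]. *)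
have aux (Il Ia Iu Jl Jm Jv : bool) : Il ==> Ia -> Iu ==> Ia -> Jl ==> Jm -> Jv ==> Jm ->
    (~~ [|| Iu, Jv | Ia && Jm] && ~~ (Il || Jl))%:R =
    - ((~~ Ia)%:R * (~~ Jm)%:R) + (~~ Iu && ~~ Il)%:R * (~~ Jm)%:R
    + (~~ Ia)%:R * (~~ Jv && ~~ Jl)%:R :> rat.
  by case: Il; case: Ia; case: Iu; case: Jl; case: Jm; case: Jv.
case: n => [|n].
  by rewrite tot0 !convX0 coef1 /norotincr !occurs_nil !(addr0, subr0).
rewrite !convXS coef1 add0r tot_rec.
(* In this product the factor [norotincr] concerns the left part u, so it is moved to the left. *)
rewrite [conv (tot (noincr m.+1)) _ n]convC -!sum_splice_conv -sumrN -!big_split.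
apply: eq_bigr => i _; rewrite -sumrN -!big_split; apply: eq_big_seq => u ui.
rewrite -sumrN -!big_split; apply: eq_big_seq => v vi /=.
have lein : (i <= n)%N by exact: ltn_ord i.
have := splice_rotinc a m ui vi; have := splice_incr l ui vi.
rewrite subnKC // /norotincr /noincr => -> ->.
apply: aux; apply/implyP.
- exact: occurs_incr_leq.
- by move/occurs_rotinc_incr; apply: occurs_incr_leq.
- exact: (@occurs_incr_leq l.+1 m.+1) (leq_trans lema leal).
- by move/occurs_rotinc_incr; apply: (@occurs_incr_leq a.+1 m.+1).
Qed.

Lemma has_expansion_noincr l : has_expansion (tot (noincr l)) (contfrac l).
Proof.
elim: l => [|l IH].
  apply: eq_has_expansion (has_expansion_poly 0) => [n|]; first by rewrite coef0 tot_noincr0.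
  by rewrite polyQxE comp_poly0 tofrac0.
have O := has_expansion_poly 1; rewrite polyQx1 in O.
by rewrite contfracS; apply: has_expansion_fix O IH (tot_noincrS l).
Qed.

(** Induction on the excess [e] of the forbidden length over $k-m=a+1$; for [e = 0] the formula
    collapses to $R_{k-m}$. *)
Lemma has_expansion_norotincr a m e : (m <= a)%N ->
  has_expansion (tot (norotincr a.+1 m.+1 (a.+1 + e)))
    (contfrac (a.+1 + m.+1) - (varx * contfrac a.+1 * contfrac m.+1) ^+ e
       * (contfrac (a.+1 + m.+1) - contfrac a.+1)).
Proof.
move=> lema; elim: e => [|e IH].
  rewrite addn0 expr0 mul1r subKr.
  apply: eq_has_expansion (has_expansion_noincr a.+1) => // n.
  by rewrite tot_norotincr_base.
rewrite -contfrac_step addnS.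
have Wa := has_expansion_noincr a; have Wm := has_expansion_noincr m.+1.
have X := has_expansion_poly 'X; rewrite polyQxX in X.
have O := has_expansion_poly 1; rewrite polyQx1 in O.
(* The unknown series occurs on the right only multiplied by $xR_a$; everything else is known from
   the previous excess. *)
apply: has_expansion_fix (has_expansionD (has_expansionD O (has_expansionN
  (has_expansionM X (has_expansionM Wa Wm)))) (has_expansionM X (has_expansionM Wm IH))) Wa _.
by move=> n; apply: tot_norotincrS; rewrite lema addSn leqW // leq_addr.
Qed.

Theorem theorem5p15 (k m l : nat)
    (hm : (1 <= m <= k - 1)%N) (hkm : (m <= k - m)%N) (hl : (k - m < l)%N) :
  has_expansion (Fbar (pat_rot k m) (pat_id l))
    (R_ k - (varx * R_ (k - m) * R_ m) ^+ (l + m - k) * (R_ k - R_ (k - m))).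
Proof.
have lemk : (m <= k)%N by lia.
(* Both block lengths are positive, since $k-m\ge m\ge 1$, and are written as successors [m + 1] and
   [a + 1]. *)
case: m hm hkm hl lemk => [|m] // hm hkm hl lemk.
case E: (k - m.+1)%N (hkm) => [|a] // lema.
have Ek : k = (a.+1 + m.+1)%N by lia.
(* The exponent is the excess of [l] over $k-m$; the subtraction is not truncated because
   $l>k-m$. *)
have El : l = (a.+1 + (l + m.+1 - k))%N by lia.
have k0 : (0 < k)%N by rewrite Ek.
rewrite !R_contfrac //.
have := @has_expansion_norotincr a m (l + m.+1 - k) lema.
rewrite -El -Ek; apply: eq_has_expansion => // n.
rewrite /Fbar card_avoiders132 /tot -sum1_count natr_sum [RHS]big_mkcond /=.
apply: eq_bigr => w _.
rewrite (eq_occurs _ (ordiso_rot lemk)) (eq_occurs _ (ordiso_id l)) E.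
by rewrite /norotincr; case: ifP.
Qed.
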